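(* For every $k \in \mathbb{N}$, the sequence of positive integers $$\left(\frac{\binom{n}{k}}{\left[\begin{array}{c} n \\ k \end{array}\right]}\right)_{n \geq k}, \qquad \text{where } \left[\begin{array}{c} n \\ k \end{array}\right] := \frac{\mathrm{lcm}(n, n-1, \dots, n-k+1)}{\mathrm{lcm}(1, 2, \dots, k)},$$ is periodic, and its smallest period $T_k$ is $$T_k = \prod_{p \text{ prime},\ p < k} p^{\alpha_p},$$ where for each prime $p < k$, $$\alpha_p = \begin{cases} 0 & \text{if } v_p(k) \geq \max_{1 \leq i < k} v_p(i), \\ \max_{1 \leq i < k} v_p(i) & \text{otherwise.}\end{cases}$$
   Context: $\mathbb{N}$ denotes the set of nonnegative integers. The least common multiple of the empty set is taken to be $1$. $v_p$ denotes the $p$-adic valuation. An empty product equals $1$. The quotients $\binom{n}{k}/\left[\begin{smallmatrix} n \\ k\end{smallmatrix}\right]$ are positive integers. *)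

(* Defs.v *)
From mathcomp Require Import all_boot all_order all_algebra.

Set Implicit Arguments.
Unset Strict Implicit.
Unset Printing Implicit Defensive.

Import GRing.Theory.

Definition lcm_falling (n k : nat) : nat := \big[lcmn/1%N]_(0 <= i < k) (n - i).

Definition lcm_upto (k : nat) : nat := \big[lcmn/1%N]_(1 <= i < k.+1) i.

(* Both divisions are exact divisions of rationals, so no divisibility is
   presupposed.  Only the values with k <= n are meaningful: otherwise n - i is
   a truncated subtraction. *)
Definition lcm_bin (n k : nat) : rat :=
  ((lcm_falling n k)%:R / (lcm_upto k)%:R)%R.

Definition bin_quot (k n : nat) : rat := ('C(n, k)%:R / lcm_bin n k)%R.

Definition is_period_from (T : Type) (k : nat) (u : nat -> T) (t : nat) : Prop :=
  0 < t /\ forall n : nat, k <= n -> u (n + t) = u n.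

Definition is_smallest_period_from
    (T : Type) (k : nat) (u : nat -> T) (t : nat) : Prop :=
  is_period_from k u t /\ forall t' : nat, is_period_from k u t' -> t <= t'.

Definition max_val (p k : nat) : nat := \max_(1 <= i < k) logn p i.

Definition alpha (k p : nat) : nat :=
  if max_val p k <= logn p k then 0 else max_val p k.

Definition Tk (k : nat) : nat := \prod_(0 <= p < k | prime p) p ^ alpha k p.

(* Main.v *)
Require Import Defs.
From mathcomp Require Import all_boot all_order all_algebra.
From mathcomp Require Import zify.

(** Fix a prime p and let M = max_{1 <= i < k} v_p(i), so that
    p^M <= k <= p^(M+1).  Among k consecutive positive integers at least one is
    divisible by p^M and at most one by p^(M+1).  Hence passing from the sum of
    the valuations of n, ..., n-k+1 to that sum minus its largest term amounts
    to truncating every valuation at M and subtracting M once.  As in Legendre's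
    formula the truncated valuations of 1, ..., n add up to
    W(n) = sum_{1 <= e <= M} floor(n / p^e), and the valuation of the quotient
    is W(n) - W(n-k) - W(k).  This is nonnegative, has period p^M in n, and
    vanishes if p^M divides k.

    Conversely let t be a period and v_p(k) = b < M.  Comparing the increments of
    the valuation at N = p^M k and at N + t, and writing w = min(M, v_p), gives
    M - b = w(N + t) - w(N + t - k); as w(N + t - k) >= min(w(N + t), b), this
    forces w(N + t) = M, that is, p^M divides t. *)

(** * Valuations of products and least common multiples *)

Lemma logn_nonprime (p m : nat) : ~~ prime p -> logn p m = 0.
Proof. by move=> /negbTE pN; rewrite lognE pN. Qed.

Lemma dvdn_from_log (m n : nat) : 0 < m -> 0 < n ->
  (forall p, prime p -> logn p m <= logn p n) -> m %| n.
Proof.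
move=> m0 n0 H; suff -> : n = lcmn m n by apply: dvdn_lcml.
apply: eqn_from_log => // [|p]; first by rewrite lcmn_gt0 m0.
rewrite logn_lcm //; case: (boolP (prime p)) => [/H/maxn_idPr->//|pN].
by rewrite !logn_nonprime.
Qed.

Lemma logn_prod_ord (p k : nat) (F : 'I_k -> nat) : (forall i, 0 < F i) ->
  logn p (\prod_i F i) = \sum_i logn p (F i).
Proof.
move=> F0; suff [] : 0 < \prod_i F i /\ logn p (\prod_i F i) = \sum_i logn p (F i) by [].
apply: (big_ind2 (fun x y => 0 < x /\ logn p x = y)) => [|x1 x2 y1 y2 [? <-] [? <-]|//].
  by rewrite logn1.
by rewrite muln_gt0 lognM //; split=> //; apply/andP.
Qed.

Lemma logn_biglcm_ord (p k : nat) (F : 'I_k -> nat) : (forall i, 0 < F i) ->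
  logn p (\big[lcmn/1]_i F i) = \max_i logn p (F i).
Proof.
move=> F0.
suff [] : 0 < \big[lcmn/1]_i F i /\ logn p (\big[lcmn/1]_i F i) = \max_i logn p (F i) by [].
apply: (big_ind2 (fun x y => 0 < x /\ logn p x = y)) => [|x1 x2 y1 y2 [? <-] [? <-]|//].
  by rewrite logn1.
by rewrite lcmn_gt0 logn_lcm //; split=> //; apply/andP.
Qed.

Lemma biglcmn_gt0 (k : nat) (F : 'I_k -> nat) : (forall i, 0 < F i) ->
  0 < \big[lcmn/1]_i F i.
Proof.
move=> F0; apply: (big_ind (fun x => 0 < x)) => // x y x0 y0.
by rewrite lcmn_gt0 x0.
Qed.

(** * The exponent [max_val] and the truncated Legendre sum *)

Lemma max_val_exp_le (p k : nat) : prime p -> 0 < k -> p ^ max_val p k <= k.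
Proof.
move=> pp k0; rewrite /max_val big_nat_cond.
apply: (big_ind (fun x => p ^ x <= k)) => // [x y Hx Hy|i].
  by rewrite /maxn; case: ifP.
rewrite andbT => /andP[i0 ik]; apply: leq_trans (ltnW ik).
by apply: dvdn_leq => //; apply: pfactor_dvdnn.
Qed.

(** Otherwise [p ^ (max_val p k).+1] would itself be an index below [k], of valuation larger than
    the maximum. *)
Lemma max_val_exp_ge (p k : nat) : prime p -> k <= p ^ (max_val p k).+1.
Proof.
move=> pp; rewrite leqNgt; apply/negP => lt.
have: logn p (p ^ (max_val p k).+1) <= max_val p k.
  apply: (leq_bigmax_seq (F := logn p)) => //.
  by rewrite mem_index_iota lt expn_gt0 prime_gt0.
by rewrite pfactorK // ltnn.
Qed.

Lemma max_val_eq0 (p k : nat) : prime p -> k <= p -> max_val p k = 0.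
Proof.
move=> pp kp; rewrite /max_val big_nat_cond big1 // => i.
rewrite andbT => /andP[i0 ik]; rewrite lognE.
case: ifP => // /and3P[_ _ /(dvdn_leq i0)].
by rewrite leqNgt (leq_trans ik kp).
Qed.

(* Legendre's formula for [n`!], with the valuations truncated at [M]. *)
Definition trunc_legendre (p M n : nat) : nat := \sum_(1 <= e < M.+1) n %/ p ^ e.

(** The term of exponent [e] increases, by one, exactly when [p ^ e] divides [n.+1]; this happens
    for [minn M (logn p n.+1)] of the exponents from 1 to [M]. *)
Lemma trunc_legendreS (p M n : nat) : prime p ->
  trunc_legendre p M n.+1 = trunc_legendre p M n + minn M (logn p n.+1).
Proof.
move=> pp; rewrite /trunc_legendre; elim: M => [|M IH].
  by rewrite !big_geq // min0n.
rewrite big_nat_recr //= IH [in RHS]big_nat_recr //= divnS ?expn_gt0 ?prime_gt0 //.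
rewrite pfactor_dvdn //; case: ltnP => /=; lia.
Qed.

Lemma trunc_legendre_dvdD (p M m n : nat) : p ^ M %| m ->
  trunc_legendre p M (m + n) = trunc_legendre p M m + trunc_legendre p M n.
Proof.
move=> dm; rewrite /trunc_legendre -big_split /=.
apply: eq_big_nat => e /andP[_ eM]; apply: divnDl.
by apply: dvdn_trans dm; apply: dvdn_exp2l.
Qed.

Lemma trunc_legendre_superadd (p M m n : nat) : prime p ->
  trunc_legendre p M m + trunc_legendre p M n <= trunc_legendre p M (m + n).
Proof.
move=> pp; rewrite /trunc_legendre -big_split /=; apply: leq_sum => e _.
by rewrite divnD ?expn_gt0 ?prime_gt0 // leq_addr.
Qed.

Lemma sum_trunc_logn (p M n k : nat) : prime p -> k <= n ->
  \sum_(i < k) minn M (logn p (n - i)) + trunc_legendre p M (n - k) = trunc_legendre p M n.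
Proof.
move=> pp; elim: k => [|k IH] kn; first by rewrite big_ord0 subn0.
rewrite -IH 1?ltnW // big_ord_recr /= -addnA; congr addn.
have -> : n - k = (n - k.+1).+1 by lia.
by rewrite trunc_legendreS // addnC.
Qed.

(** * Valuation of the quotient *)

Lemma logn_ffact_lcm_falling (p n k : nat) : prime p -> k <= n ->
  logn p (n ^_ k) + max_val p k + trunc_legendre p (max_val p k) (n - k)
  = logn p (lcm_falling n k) + trunc_legendre p (max_val p k) n.
Proof.
move=> pp kn; rewrite -[in RHS](sum_trunc_logn _ _ _ _ pp kn) addnA; congr addn.
rewrite ffact_prod /lcm_falling big_mkord.
have F0 (i : 'I_k) : 0 < n - i by have := ltn_ord i; lia.
rewrite logn_prod_ord // logn_biglcm_ord //.
case: k kn F0 => [|k] kn F0; first by rewrite !big_ord0 /max_val big_geq.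
have le1 := max_val_exp_le p k.+1 pp isT.
have le2 := max_val_exp_ge p k.+1 pp.
move: (max_val p k.+1) le1 le2 => M le1 le2.
rewrite (bigmax_eq_arg (ord0 : 'I_k.+1)) //.
case: arg_maxnP => // i0 _ imax.
have Mi0 : M <= logn p (n - i0).
  have d0 : 0 < p ^ M by rewrite expn_gt0 prime_gt0.
  (* The offset [n %% p ^ M] reaches the multiple of [p ^ M] just below or at [n]; it lies in the
     window because [p ^ M <= k.+1]. *)
  have jk : n %% p ^ M < k.+1 by apply: leq_trans le1; rewrite ltn_mod.
  apply: leq_trans (imax (Ordinal jk) isT).
  rewrite -pfactor_dvdn //=; last exact: (F0 (Ordinal jk)).
  by rewrite [X in X - _](divn_eq n (p ^ M)) addnK dvdn_mull.
rewrite (bigD1 i0) //= [in RHS](bigD1 i0) //= (minn_idPl Mi0).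
rewrite -addnA; congr addn; rewrite addnC; congr addn.
(* A second term of valuation above [M] would make [p ^ M.+1] divide the nonzero difference of two
   indices, which is less than [k.+1 <= p ^ M.+1]. *)
apply: eq_bigr => j ji; apply/esym/minn_idPr; rewrite leqNgt; apply/negP => Mj.
have Mi : M < logn p (n - i0) by apply: leq_trans Mj (imax j isT).
have := Mi; have := Mj; rewrite -!pfactor_dvdn // => dj di.
have neq : (j : nat) <> i0 by move=> e; move: ji; rewrite (val_inj e) eqxx.
have ltj := ltn_ord j; have lti := ltn_ord i0.
case: (ltnP j i0) => ij.
  have := dvdn_sub dj di; have -> : n - j - (n - i0) = i0 - j by lia.
  by move/dvdn_leq; lia.
have := dvdn_sub di dj; have -> : n - i0 - (n - j) = j - i0 by lia.
by move/dvdn_leq; lia.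
Qed.

Lemma lcm_falling_diag (k : nat) : lcm_falling k k = lcm_upto k.
Proof.
rewrite /lcm_falling /lcm_upto big_nat_rev /= big_add1 /=.
by apply: eq_big_nat => i /andP[_ ik]; lia.
Qed.

Lemma lcm_falling_gt0 (n k : nat) : k <= n -> 0 < lcm_falling n k.
Proof.
move=> kn; rewrite /lcm_falling big_mkord; apply: biglcmn_gt0 => i.
by have := ltn_ord i; lia.
Qed.

Lemma lcm_upto_gt0 (k : nat) : 0 < lcm_upto k.
Proof. by rewrite -lcm_falling_diag lcm_falling_gt0. Qed.

(** Subtract the preceding identity at [n = k] from the one at [n]: the term [max_val p k] cancels.
    Sums on both sides avoid truncated subtraction. *)
Lemma logn_bin_lcm (p n k : nat) : prime p -> k <= n ->
  logn p ('C(n, k) * lcm_upto k)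
    + (trunc_legendre p (max_val p k) k + trunc_legendre p (max_val p k) (n - k))
  = logn p (lcm_falling n k) + trunc_legendre p (max_val p k) n.
Proof.
move=> pp kn; have := logn_ffact_lcm_falling p n k pp kn.
have := logn_ffact_lcm_falling p k k pp (leqnn k).
rewrite lcm_falling_diag ffactnn subnn -bin_ffact.
rewrite !lognM ?bin_gt0 ?fact_gt0 ?lcm_upto_gt0 //.
have -> : trunc_legendre p (max_val p k) 0 = 0.
  by rewrite /trunc_legendre big1 // => e _; rewrite div0n.
lia.
Qed.

Lemma lcm_falling_dvd (n k : nat) : k <= n -> lcm_falling n k %| 'C(n, k) * lcm_upto k.
Proof.
move=> kn; apply: dvdn_from_log => [||p pp]; first exact: lcm_falling_gt0.
  by rewrite muln_gt0 bin_gt0 kn lcm_upto_gt0.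
have := logn_bin_lcm p n k pp kn.
have := trunc_legendre_superadd p (max_val p k) k (n - k) pp.
rewrite subnKC //; lia.
Qed.

Definition nat_quot (k n : nat) : nat := 'C(n, k) * lcm_upto k %/ lcm_falling n k.

Lemma nat_quot_gt0 (k n : nat) : k <= n -> 0 < nat_quot k n.
Proof.
move=> kn; rewrite divn_gt0 ?lcm_falling_gt0 //.
by rewrite dvdn_leq ?lcm_falling_dvd // muln_gt0 bin_gt0 kn lcm_upto_gt0.
Qed.

Lemma bin_quot_nat (k n : nat) : k <= n -> bin_quot k n = (nat_quot k n)%:R%R.
Proof.
move=> kn; have lf0 : ((lcm_falling n k)%:R : rat)%R != 0%R.
  by rewrite Num.Theory.pnatr_eq0 -lt0n lcm_falling_gt0.
apply: (GRing.mulIf lf0); rewrite -GRing.natrM /nat_quot divnK ?lcm_falling_dvd //.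
by rewrite /bin_quot /lcm_bin GRing.invf_div GRing.mulrA GRing.divfK // GRing.natrM.
Qed.

Lemma logn_nat_quot (p n k : nat) : prime p -> k <= n ->
  logn p (nat_quot k n)
    + (trunc_legendre p (max_val p k) k + trunc_legendre p (max_val p k) (n - k))
  = trunc_legendre p (max_val p k) n.
Proof.
move=> pp kn; have := logn_bin_lcm p n k pp kn.
rewrite /nat_quot logn_div ?lcm_falling_dvd //.
have := dvdn_leq_log p _ (lcm_falling_dvd n k kn).
rewrite muln_gt0 bin_gt0 kn lcm_upto_gt0 => /(_ isT); lia.
Qed.

Lemma Tk_gt0 (k : nat) : 0 < Tk k.
Proof. by apply: prodn_cond_gt0 => p pp; rewrite expn_gt0 prime_gt0. Qed.

Lemma dvdn_Tk (k p : nat) : prime p -> p < k -> p ^ alpha k p %| Tk k.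
Proof.
move=> pp pk; rewrite /Tk big_mkord (bigD1 (Ordinal pk)) //=.
exact: dvdn_mulr.
Qed.

(** Powers of distinct primes are coprime, so their product divides [t] as soon as each does; the
    induction is on the upper end of the range of primes. *)
Lemma Tk_dvdn (k t : nat) :
  (forall p, prime p -> p < k -> p ^ alpha k p %| t) -> Tk k %| t.
Proof.
move=> H.
suff dvd m : m <= k -> \prod_(0 <= p < m | prime p) p ^ alpha k p %| t by exact: dvd.
elim: m => [|m IH] mk.
  by rewrite big_geq.
rewrite big_mkcond big_nat_recr //= -big_mkcond /=.
case: ifP => [mp|_]; last by rewrite muln1 IH // ltnW.
rewrite Gauss_dvd; first by rewrite IH ?H // ltnW.
rewrite coprime_sym big_nat_cond.
apply: (big_ind (coprime (m ^ alpha k m))) => [|x y|q]; first exact: coprimen1.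
  by rewrite coprimeMr => -> ->.
case/andP=> /andP[_ qm] qp; apply: coprimeXl; apply: coprimeXr.
by rewrite prime_coprime // dvdn_prime2 // gtn_eqF.
Qed.

Lemma nat_quot_period (k n : nat) : k <= n -> nat_quot k (n + Tk k) = nat_quot k n.
Proof.
move=> kn; have knT : k <= n + Tk k by apply: leq_trans kn (leq_addr _ _).
apply: eqn_from_log => [||p]; rewrite ?nat_quot_gt0 //.
case: (boolP (prime p)) => [pp|pN]; last by rewrite !logn_nonprime.
have := logn_nat_quot p _ k pp kn; have := logn_nat_quot p _ k pp knT.
have [k0|k0] := posnP k.
  by rewrite k0 /max_val big_geq // /trunc_legendre !big_geq //; lia.
(* If [p ^ max_val p k] divides [k], the sums split at [k] and both valuations vanish. Otherwise
   [alpha k p] is [max_val p k] when [p < k], and [max_val p k] is 0 when [p >= k]. *)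
case: (boolP (p ^ max_val p k %| k)) => dk.
  rewrite -{6}(subnKC kn) -{3}(subnKC knT) !trunc_legendre_dvdD //; lia.
have dT : p ^ max_val p k %| Tk k.
  case: (ltnP p k) => pk; last by rewrite max_val_eq0.
  have := dvdn_Tk k p pp pk; rewrite /alpha; case: leqP => // H.
  by move: dk; rewrite pfactor_dvdn // H.
have -> : n + Tk k - k = Tk k + (n - k) by lia.
rewrite [n + Tk k]addnC !trunc_legendre_dvdD //; lia.
Qed.

Lemma period_pfactor_dvd (p k t : nat) : prime p -> logn p k < max_val p k ->
  (forall n, k <= n -> nat_quot k (n + t) = nat_quot k n) -> p ^ max_val p k %| t.
Proof.
move=> pp bM per.
have k1 : 1 < k.
  by case: k bM {per} => [|[|k]] //; rewrite /max_val big_geq.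
have H m (km : k <= m) := logn_nat_quot p m k pp km.
move: H; move: (max_val p k) bM => M bM H.
have k0 : 0 < k by lia.
have q2 : 1 < p ^ M by rewrite -(exp1n M) ltn_exp2r ?prime_gt1 //; lia.
have pMN : p ^ M %| p ^ M * k by apply: dvdn_mulr.
have Nk : k < p ^ M * k by rewrite ltn_Pmull.
(* Since [M > 0], the factor [p ^ M - 1] is prime to [p]. *)
have wNk : logn p (p ^ M * k - k) = logn p k.
  rewrite -{2}(mul1n k) -mulnBl lognM ?subn_gt0 //.
  rewrite -[RHS]add0n; congr addn; rewrite lognE subn_gt0 q2 pp.
  rewrite dvdn_subr ?(ltnW q2) ?dvdn1 ?gtn_eqF ?prime_gt1 //.
  by rewrite -{1}(expn1 p) dvdn_exp2l //; lia.
(* The number N of the overview becomes [n.+1]; as [k < n.+1], the increment from [n] to [n.+1]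
   starts inside the range [k <= n]. *)
move: (p ^ M * k) pMN Nk wNk => [//|n] pMN kn wNk.
have step m : k <= m ->
    logn p (nat_quot k m.+1) + minn M (logn p (m.+1 - k))
    = logn p (nat_quot k m) + minn M (logn p m.+1).
  move=> km; have := H m km; have := H m.+1 (leqW km).
  rewrite subSn // !trunc_legendreS //; lia.
have s1 := step n kn.
have s2 := step (n + t) (leq_trans kn (leq_addr _ _)).
have p1 := per n kn; have p2 := per n.+1 (leqW kn); rewrite addSn in p2.
rewrite p1 p2 in s2.
have MN : M <= logn p n.+1 by rewrite -pfactor_dvdn.
have wmin : minn (minn M (logn p (n + t).+1)) (logn p k) <= logn p ((n + t).+1 - k).
  rewrite -pfactor_dvdn // ?subn_gt0; last lia.
  by apply: dvdn_sub; rewrite pfactor_dvdn //; lia.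
(* If w(N + t) were at most b, [wmin] would give w(N + t - k) >= w(N + t), against M - b > 0. So w(N
   + t - k) >= b, whence w(N + t) >= M. *)
have : M <= logn p (n + t).+1 by rewrite wNk in s1; lia.
by rewrite -pfactor_dvdn // -addSn dvdn_addr.
Qed.

Theorem theorem2 (k : nat) :
  (forall n : nat, k <= n -> exists m : nat, 0 < m /\ bin_quot k n = m%:R%R)
  /\ is_smallest_period_from k (bin_quot k) (Tk k).
Proof.
split=> [n kn|].
  by exists (nat_quot k n); rewrite nat_quot_gt0 // bin_quot_nat.
split=> [|t [t0 per]].
  split=> [|n kn]; first exact: Tk_gt0.
  by rewrite !bin_quot_nat ?nat_quot_period // (leq_trans kn) ?leq_addr.
(* Minimality holds in the stronger form that [Tk k] divides every period. *)
apply: dvdn_leq => //; apply: Tk_dvdn => p pp _; rewrite /alpha.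
case: leqP => [_|bM]; first exact: dvd1n.
apply: period_pfactor_dvd => // n kn; have := per n kn.
rewrite !bin_quot_nat ?(leq_trans kn) ?leq_addr // => /eqP.
by rewrite Num.Theory.eqr_nat => /eqP.
Qed.
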